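(* Let $(B,+,\circ)$ be a finite skew brace such that one of the groups $(B,+)$, $(B,\circ)$ is cyclic and the other is nilpotent. Then $B$ is Dedekind.
   Context: A skew brace is a triple $(B,+,\circ)$ with $(B,+)$, $(B,\circ)$ (not necessarily abelian) groups such that $a\circ(b+c)=a\circ b-a+a\circ c$ for all $a,b,c\in B$. For $a\in B$ put $\lambda_a(b)=-a+a\circ b$; then $\lambda:a\mapsto\lambda_a$ is a homomorphism $(B,\circ)\to\operatorname{Aut}(B,+)$. A sub-skew brace is a subset that is a subgroup of both $(B,+)$ and $(B,\circ)$. An ideal is a subgroup of $(B,+)$ that is normal in $(B,+)$, invariant under all $\lambda_b$, and normal in $(B,\circ)$. $B$ is Dedekind if all its sub-skew braces are ideals of $B$. *)

(* Defs.v *)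
From HB Require Import structures.
From mathcomp Require Import all_boot all_fingroup all_solvable.

Set Implicit Arguments.
Unset Strict Implicit.
Unset Printing Implicit Defensive.

Declare Scope brace_scope.
Delimit Scope brace_scope with B.

(* Each group law carries its own neutral element; that sb0 = sb1 is a
   consequence of the axioms.  Neither law is assumed to be commutative. *)
HB.mixin Record isSkewBrace (B : Type) := {
  sbadd : B -> B -> B;
  sb0 : B;
  sbopp : B -> B;
  sbcirc : B -> B -> B;
  sb1 : B;
  sbinv : B -> B;
  sbaddA : associative sbadd;
  sbadd0l : left_id sb0 sbadd;
  sbaddNl : left_inverse sb0 sbopp sbadd;
  sbcircA : associative sbcirc;
  sbcirc1l : left_id sb1 sbcirc;
  sbcircVl : left_inverse sb1 sbinv sbcirc;
  sbcircDr : forall a b c : B,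
    sbcirc a (sbadd b c) = sbadd (sbadd (sbcirc a b) (sbopp a)) (sbcirc a c)
}.

#[short(type="skewBraceType")]
HB.structure Definition SkewBrace := {B of isSkewBrace B}.

#[short(type="finSkewBraceType")]
HB.structure Definition FinSkewBrace := {B of SkewBrace B & Finite B}.

Notation "a + b" := (sbadd a b) : brace_scope.
Notation "- a" := (sbopp a) : brace_scope.
Notation "a \circ b" := (sbcirc a b)
  (at level 40, left associativity) : brace_scope.

(* Aliases of B carrying the groups (B,+) and (B,\circ), both written
   multiplicatively as MathComp finGroupTypes.  They share the finType structure
   of B, so a term of type {set B} is also a set in either group. *)
Definition addgroup (B : finSkewBraceType) : Type := B.
HB.instance Definition _ (B : finSkewBraceType) := Finite.on (addgroup B).
HB.instance Definition _ (B : finSkewBraceType) :=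
  Finite_isGroup.Build (addgroup B)
    (@sbaddA B) (@sbadd0l B) (@sbaddNl B).

Definition circgroup (B : finSkewBraceType) : Type := B.
HB.instance Definition _ (B : finSkewBraceType) := Finite.on (circgroup B).
HB.instance Definition _ (B : finSkewBraceType) :=
  Finite_isGroup.Build (circgroup B)
    (@sbcircA B) (@sbcirc1l B) (@sbcircVl B).

Definition sblambda (B : skewBraceType) (a b : B) : B := (- a + a \circ b)%B.

Definition sub_skew_brace (B : finSkewBraceType) (S : {set B}) : bool :=
  group_set (S : {set addgroup B}) && group_set (S : {set circgroup B}).

Definition brace_ideal (B : finSkewBraceType) (I : {set B}) : Prop :=
  [/\ group_set (I : {set addgroup B}),
      ((I : {set addgroup B}) <| [set: addgroup B])%g,
      forall b x : B, x \in I -> sblambda b x \in I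
    & ((I : {set circgroup B}) <| [set: circgroup B])%g].

Definition dedekind (B : finSkewBraceType) : Prop :=
  forall S : {set B}, sub_skew_brace S -> brace_ideal S.

(* Main.v *)
Require Import Defs.
From mathcomp Require Import all_boot all_fingroup all_solvable.

Set Implicit Arguments.
Unset Strict Implicit.
Unset Printing Implicit Defensive.
Import GroupScope.

(** Both groups of [B] are nilpotent, and everything reduces to one prime at a
time.  The subgroup O_pi of [(B,+)] is characteristic, hence invariant under
every [lambda_a], hence also a subgroup of [(B,\circ)]; comparing orders, it is
the O_pi of [(B,\circ)] ([pcore_circE]).  In each of the two groups, O_pi and
O_pi' commute and meet trivially, which forces [lambda_x y = y] for [x] in O_pi
and [y] in O_pi' ([lam_pcoreC]).  So a sub-skew brace [S] is an ideal as soon as,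
for each prime [p], the elements of [P = O_p] send [S :&: P] into [S] by
[lambda] and by conjugation in both groups ([brace_ideal_local]).

If [(B,\circ)] is cyclic, let [P] act on its additive group by [lambda].  The
semidirect product is a p-group in which the additive copy of [P] is normal, so
it has normal subgroups of every possible order inside that copy
([p_gact_invariant_normal]).  Such a subgroup [I] is normalised by [P] and
[lambda]-invariant, therefore a subgroup of [(B,\circ)]; as a cyclic group has
one subgroup of each order, choosing [I] of the same order as [S :&: P] gives
[I = S :&: P].

If [(B,+)] is cyclic, write [P = <g>] with [g] of order [p^n].  Every additive
subgroup of [P] is one of the [U_m], of order [p^m], and is [lambda]-invariant;
what remains is that [P] normalises [U_m] in [(B,\circ)], which amounts to
[lambda_x] being trivial on [P / U_m] for [x] in [U_m].  This goes by induction
on [m] ([circ_conj_cycle_expg]).  Let [x] be in [U_(m+1)]; on [P], [lambda_x] is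
multiplication by some [u], and [u^(p^(m+1)) = 1] modulo [p^n].  That alone does
not give [u = 1] modulo [p^(n-m-1)] when [p = 2], since [u = -1] has to be
excluded.  But [U_(m+2) / U_m] has order [p^2] in [(B,\circ)], so it is abelian,
and comparing [x \circ y] with [y \circ x] for a generator [y] of [U_(m+2)] gives
[u = 1] modulo [p^2].  Then the exponent-lifting lemma [lifting_exponent]
applies, for every prime. *)

(** * Congruences modulo prime powers *)

(** [u^p - 1] is [u - 1] times a sum of [p] powers of [u].  That sum is [p] modulo
[p^2], so it contributes exactly one factor [p]. *)
Lemma dvd_exp_prime_sub1 p u n : prime p ->
  u = 1 %[mod p ^ 2] -> u ^ p = 1 %[mod p ^ n.+1] -> u = 1 %[mod p ^ n].
Proof.
move=> pr_p u1 up1; have p_gt1 := prime_gt1 pr_p; have p_gt0 := prime_gt0 pr_p.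
have [u0 | u_gt0] := posnP u.
  by move: u1; rewrite u0 mod0n modn_small // (ltn_exp2l 0).
apply/eqP; rewrite eqn_mod_dvd //; move/eqP: up1.
rewrite eqn_mod_dvd ?expn_gt0 ?u_gt0 //.
rewrite -{1}(exp1n p) subn_exp; set s := (\sum_(i < p) _)%N.
have: s = p %[mod p ^ 2].
  have -> : p %% p ^ 2 = (\sum_(i < p) 1) %% p ^ 2 by rewrite sum1_card card_ord.
  rewrite -modn_summ -[RHS]modn_summ; congr (_ %% _).
  by apply: eq_bigr => i _; rewrite exp1n muln1 -modnXm u1 modnXm exp1n.
move=> s_p; have /dvdnP[q def_s] : p %| s.
  rewrite /dvdn -(modn_dvdm s (dvdn_exp (isT : 0 < 2) (dvdnn p))) s_p.
  by rewrite modn_dvdm ?modnn ?dvdn_exp.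
have: (q * p = 1 * p %[mod p * p])%N by rewrite mul1n -def_s s_p mulnn.
rewrite -!muln_modl => /eqP; rewrite eqn_pmul2r // => /eqP q1.
rewrite def_s mulnA expnSr dvdn_pmul2r // Gauss_dvdl // coprimeXl //.
by rewrite -coprime_modr q1 coprime_modr coprimen1.
Qed.

Lemma lifting_exponent p u j n : prime p ->
  u = 1 %[mod p ^ 2] -> u ^ (p ^ j) = 1 %[mod p ^ n] -> u = 1 %[mod p ^ (n - j)].
Proof.
move=> pr_p; elim: j n => [|j IHj] [|n] u1; rewrite ?subn0 ?expn0 ?modn1 ?expn1 //.
rewrite subSS expnSr expnM => upj1; apply: IHj => //.
by apply: dvd_exp_prime_sub1 upj1 => //; rewrite -modnXm u1 modnXm exp1n.
Qed.

(** This is the comparison of [x \circ y] with [y \circ x] read on exponents of a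
generator: dividing by [p^k] leaves [p i + u = 1 + p i v + p^2 l], and [p v = p]
modulo [p^2]. *)
Lemma mod_p2_cancel p k m i l u v : 0 < p -> (v = 1 %[mod p])%N ->
    (p ^ k.+1 * i + p ^ k * u
       = p ^ k + p ^ k.+1 * i * v + p ^ k.+2 * l %[mod p ^ (k + (2 + m))])%N ->
  (u = 1 %[mod p ^ 2])%N.
Proof.
move=> p_gt0 v1; rewrite expnD (expnSr p k.+1) (expnSr p k).
have -> : (p ^ k * p * i + p ^ k * u = p ^ k * (p * i + u))%N.
  by rewrite mulnDr mulnA.
have -> : (p ^ k + p ^ k * p * i * v + p ^ k * p * p * l
           = p ^ k * (p * (i * v) + 1 + p ^ 2 * l))%N.
  by rewrite !mulnDr muln1 -mulnn !mulnA [X in (X + _)%N]addnC.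
rewrite -!muln_modr => /eqP; rewrite eqn_pmul2l ?expn_gt0 ?p_gt0 // => /eqP eq2m.
have dv : p ^ 2 %| p ^ (2 + m) by rewrite dvdn_exp2l ?leq_addr.
have : (p * i + u = p * (i * v) + 1 + p ^ 2 * l %[mod p ^ 2])%N.
  by rewrite -(modn_dvdm _ dv) eq2m modn_dvdm.
rewrite [in RHS]addnC (mulnC _ l) modnMDl.
have -> : ((p * (i * v) + 1) %% p ^ 2 = (p * i + 1) %% p ^ 2)%N.
  apply/eqP; rewrite eqn_modDr -mulnn -!muln_modr eqn_pmul2l // -modnMmr v1.
  by rewrite modnMmr muln1.
by move/eqP; rewrite eqn_modDl => /eqP.
Qed.

Lemma fermat_iter p u j : prime p -> u ^ (p ^ j) = u %[mod p].
Proof.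
move=> pr_p; elim: j => [|j IHj]; first by rewrite expn1.
by rewrite expnSr expnM fermat_little.
Qed.

Lemma expg_mod1_mem (gT : finGroupType) (g a : gT) d u :
  (u = 1 %[mod d])%N -> a \in <[g]> -> a ^+ u * a^-1 \in <[g ^+ d]>.
Proof.
move=> u1 /cycleP[i ->].
have gX q : g ^+ i ^+ (q * d) \in <[g ^+ d]>.
  by rewrite -expgM mulnA mulnC expgM mem_cycle.
rewrite (divn_eq u d) u1 expgD.
have {3}-> : g ^+ i = g ^+ i ^+ (1 %/ d * d) * g ^+ i ^+ (1 %% d).
  by rewrite -expgD -divn_eq.
by rewrite invMg -mulgA mulKVg groupM ?groupV.
Qed.

(** * Reduction to elements of prime power order *)

Lemma group_ind_p_elt (gT : finGroupType) (S : {group gT}) (P : gT -> Prop) :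
    P 1 -> {in S &, forall x y, P x -> P y -> P (x * y)} ->
    (forall p x, prime p -> x \in S -> p.-elt x -> P x) ->
  {in S, forall x, P x}.
Proof.
move=> P1 PM Pp x Sx; rewrite -(prod_constt x).
set y := \prod_(0 <= p < #[x].+1) x.`_p.
suff [] : y \in S /\ P y by [].
rewrite {}/y.
elim/big_rec: _ => [|p y _ [Sy Py]]; first by rewrite group1.
have Sxp : x.`_p \in S by rewrite groupX.
split; first by rewrite groupM.
apply: PM => //; case: (boolP (prime p)) => [pr_p | npr_p].
  exact: (Pp p) (p_elt_constt _ _).
(* The product of constituents runs over all p, prime or not. *)
suff -> : x.`_p = 1 by [].
by apply/eqP; rewrite -order_eq1 order_constt p_part lognE (negPf npr_p).
Qed.

(** An element of [G] is a product of an element of O_p and one of O_p', and the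
latter centralises the p-elements of [S]. *)
Lemma nilpotent_normal_local (gT : finGroupType) (S G : {group gT}) :
    nilpotent G -> S \subset G ->
    (forall p, prime p ->
       {in S :&: 'O_p(G) & 'O_p(G), forall x y, x ^ y \in S}) ->
  S <| G.
Proof.
move=> nilG sSG nSp; rewrite /normal sSG; apply/subsetP=> y Gy.
rewrite inE; apply/subsetP=> _ /imsetP[x Sx ->]; move: x Sx.
apply: group_ind_p_elt => [|x1 x2 _ _ S1 S2|p x pr_p Sx px].
- by rewrite conj1g.
- by rewrite conjMg groupM.
have Gx := subsetP sSG x Sx.
have Px : x \in 'O_p(G).
  by rewrite (mem_normal_Hall (nilpotent_pcore_Hall p nilG)) ?pcore_normal.
have [_ defG cPP' _] := dprodP (nilpotent_pcoreC p nilG).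
move: Gy; rewrite -defG => /mulsgP[a b Pa P'b ->].
have Pxa : x ^ a \in 'O_p(G) by rewrite groupJ.
rewrite conjgM (conjgE (x ^ a)) -(centsP cPP' _ P'b _ Pxa) mulKg.
by apply: (nSp p); rewrite ?inE ?Sx.
Qed.

(** * Invariant subgroups of p-groups *)

(** In the semidirect product of [P] by [Q], a p-group, the normal subgroups
contained in [P] are the subgroups normal in [P] and invariant under [Q]. *)
Lemma p_gact_invariant_normal (aT rT : finGroupType)
    (D : {group aT}) (R : {group rT}) (to : groupAction D R)
    (p m : nat) (P : {group rT}) (Q : {group aT}) :
    P \subset R -> Q \subset D -> p.-group P -> p.-group Q ->
    [acts Q, on P | to] -> m <= logn p #|P| ->
  exists I : {group rT},
    [/\ I \subset P, P \subset 'N(I), [acts Q, on I | to] & #|I| = (p ^ m)%N].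
Proof.
move=> sPR sQD pP pQ actsQP le_m.
pose f1 := sdpair1 to; pose f2 := sdpair2 to.
have injf1 : 'injm f1 := injm_sdpair1 to.
have nPQ : f2 @* Q \subset 'N(f1 @* P) by rewrite -actsEsd.
have pG : p.-group (f1 @* P <*> f2 @* Q).
  by rewrite norm_joinEr // pgroupM !morphim_pgroup.
have nsPG : f1 @* P <| f1 @* P <*> f2 @* Q.
  by rewrite /normal joing_subl join_subG normG.
have [|I [sIP nsIG oI]] := @normal_pgroup _ _ m _ _ pG nsPG.
  by rewrite card_injm.
have [sIG nIG] := andP nsIG; rewrite join_subG in nIG; case/andP: nIG => nIP nIQ.
have sIf1 : I \subset f1 @* R := subset_trans sIP (morphimS _ sPR).
have defI : f1 @* (f1 @*^-1 I) = I := morphpreK sIf1.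
have sIR : f1 @*^-1 I \subset R := subsetIl _ _.
exists (f1 @*^-1 I)%G; split=> /=.
- by rewrite -(injmSK injf1) // defI.
- by rewrite -(injmSK injf1) // (injm_norm injf1) // defI subsetI morphimS.
- by rewrite actsEsd // defI.
- by rewrite -(card_injm injf1) // defI.
Qed.

(** * The lambda action *)

Section SkewBrace.

Variable B : finSkewBraceType.
Notation A := (addgroup B).
Notation C := (circgroup B).
Notation lam := (@sblambda B).

(** Through this equation every computation in the circle group becomes one in the
additive group. *)
Lemma circE (x y : B) : (x : C) * (y : C) = (x : A) * (lam x y : A).
Proof. exact: esym (mulKVg (x : A) (sbcirc x y)). Qed.

Lemma lamM (a x y : B) :
  lam a ((x : A) * (y : A)) = (lam a x : A) * (lam a y : A).
Proof.
rewrite [LHS](_ : _ = (a : A)^-1 * sbcirc a (sbadd x y)) // sbcircDr.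
rewrite [LHS](_ : _ = (a : A)^-1 *
  (((a : C) * (x : C) : A) * (a : A)^-1 * sbcirc a y)) //.
by rewrite !mulgA.
Qed.

Lemma lam1 (a : B) : lam a (1 : A) = 1 :> A.
Proof. by apply: (mulgI (lam a (1 : A) : A)); rewrite -lamM !mulg1. Qed.

Lemma circ1E : (1 : C) = (1 : A) :> B.
Proof. by have := circE (1 : C) (1 : A); rewrite mul1g lam1 mulg1 => /esym. Qed.

Lemma lam_circ (a b x : B) : lam ((a : C) * (b : C)) x = lam a (lam b x).
Proof.
apply: (mulgI ((a : C) * (b : C) : A)); rewrite -(circE ((a : C) * (b : C))).
rewrite -mulgA (circE a ((b : C) * (x : C))) (circE b x) (circE a b).
by rewrite (lamM a b (lam b x)) mulgA.
Qed.

Lemma lam_1 (x : B) : lam (1 : C) x = x.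
Proof.
have := circE (1 : C) x; rewrite mul1g [X in X * _](_ : _ = (1 : A)) ?mul1g //.
exact: circ1E.
Qed.

Lemma lamVK (a : C) : cancel (lam a^-1) (lam a).
Proof. by move=> x; rewrite -lam_circ mulgV lam_1. Qed.

(** The inverse turns the left action [lambda] into a right action, as required of
group actions. *)
Definition lam_act (x : A) (a : C) : A := lam a^-1 x.

Fact lam_act1 : lam_act^~ 1 =1 id.
Proof. by move=> x; rewrite /lam_act invg1 lam_1. Qed.

Fact lam_actM x : act_morph lam_act x.
Proof. by move=> a b; rewrite /lam_act invMg lam_circ. Qed.

Definition lam_action := TotalAction lam_act1 lam_actM.

Fact lam_is_groupAction : is_groupAction [set: A] lam_action.
Proof.
move=> a _; rewrite inE; apply/andP; split; first by apply/subsetP=> x; rewrite inE.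
by apply/morphicP=> x y _ _; rewrite !permE /= /lam_act lamM.
Qed.

Canonical lam_gact := GroupAction lam_is_groupAction.

Lemma acts_lamP (Q : {set C}) (S : {set A}) :
  reflect {in Q & S, forall (a : C) (x : A), (lam a^-1 x : A) \in S}
          [acts Q, on S | lam_action].
Proof.
apply: (iffP idP) => [nS a x Qa Sx | nS]; first by rewrite -(acts_act nS Qa) in Sx.
apply/subsetP=> a Qa; rewrite !inE; apply/subsetP=> x Sx; rewrite inE.
exact: nS.
Qed.

Lemma lam_char (S : {group A}) : S \char [set: A] ->
  forall (a : B) (x : A), x \in S -> (lam a x : A) \in S.
Proof.
move=> chS a x Sx; have nS := acts_char lam_gact (subsetT [set: C]) chS.
by rewrite -[a](invgK (a : C)); apply: (acts_lamP _ _ nS); rewrite ?inE.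
Qed.

(** In a finite group closure under the product suffices, and
[a \circ x = a + lambda_a x]. *)
Lemma circ_group_set (S : {group A}) :
  {in S &, forall a x : A, (lam a x : A) \in S} -> group_set (S : {set C}).
Proof.
move=> lamS; apply/group_setP; split; first by rewrite circ1E; exact: (group1 S).
by move=> x y Sx Sy; rewrite circE; exact: (@groupM A S _ _ Sx (lamS x y Sx Sy)).
Qed.

(** * Primary decomposition of a skew brace with nilpotent groups *)

Section Nilpotent.

Hypotheses (nilA : nilpotent [set: A]) (nilC : nilpotent [set: C]).

(** As a subgroup of the circle group, the additive O_pi still has the order of a
Hall subgroup, and a nilpotent group has a unique Hall pi-subgroup. *)
Lemma pcore_circE pi : 'O_pi([set: C]) = ('O_pi([set: A]) : {set B}) :> {set B}.
Proof.
pose P := 'O_pi([set: A])%G.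
have gP : group_set ('O_pi([set: A]) : {set C}).
  by apply: (@circ_group_set P) => a x _ Px; apply: lam_char Px; apply: pcore_char.
apply/esym; apply: (@nilpotent_Hall_pcore C pi [set: C] (Group gP)) => //.
have := nilpotent_pcore_Hall pi nilA.
by rewrite !pHallE !subsetT /= !cardsT.
Qed.

Lemma pcore_decomp pi (x : B) : exists h k : B,
  [/\ h \in 'O_pi([set: A]), k \in 'O_pi^'([set: A]) & x = (h : A) * (k : A)].
Proof.
have [_ defA _ _] := dprodP (nilpotent_pcoreC pi nilA).
have: (x : A) \in [set: A] by rewrite inE.
by rewrite -{1}defA => /mulsgP[h k Ph P'k ->]; exists h, k.
Qed.

(** As [x] and [y] commute for [\circ], [x + lambda_x y = y + lambda_y x]; as O_pi
and O_pi' commute for [+], this makes [- y + lambda_x y] and [lambda_y x - x]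
equal.  One lies in O_pi', the other in O_pi. *)
Lemma lam_pcoreC pi (x y : B) :
  x \in 'O_pi([set: A]) -> y \in 'O_pi^'([set: A]) -> lam x y = y.
Proof.
move=> Px P'y.
have [_ _ cA tiA] := dprodP (nilpotent_pcoreC pi nilA).
have [_ _ cC _] := dprodP (nilpotent_pcoreC pi nilC).
rewrite !pcore_circE in cC.
have cAxy := centsP cA _ P'y _ Px.
have := centsP cC _ P'y _ Px; rewrite /commute circE (circE x).
have Ply : (lam x y : A) \in 'O_pi^'([set: A]).
  by apply: lam_char P'y; apply: pcore_char.
have Plx : (lam y x : A) \in 'O_pi([set: A]).
  by apply: lam_char Px; apply: pcore_char.
rewrite -[RHS](centsP cA _ Ply _ Px) => eq_yx.
suff /mulgI -> : (y : A)^-1 * lam x y = (y : A)^-1 * y by [].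
have eq1 : (y : A)^-1 * lam x y = (lam y x : A) * (x : A)^-1.
  by apply: (mulgI (y : A)); rewrite mulKVg mulgA eq_yx mulgK.
rewrite mulVg; apply/set1gP; rewrite -tiA inE eq1 groupM ?groupV //=.
by rewrite -eq1 groupM ?groupV.
Qed.

(** Write [a = h + k] with [h] in O_p and [k] in O_p'.  Since [lambda_h k = k], also
[a = h \circ k], and [lambda_k] fixes the p-elements. *)
Lemma lam_local (S : {group A}) :
    (forall p, prime p -> {in S :&: 'O_p([set: A]) & 'O_p([set: A]),
       forall x a : A, (lam a x : A) \in S}) ->
  forall (a : B) (x : A), x \in S -> (lam a x : A) \in S.
Proof.
move=> lamS b; apply: group_ind_p_elt => [|x y _ _ Sx Sy|p x pr_p Sx px].
- by rewrite lam1 group1.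
- by rewrite lamM groupM.
have Px : x \in 'O_p([set: A]).
  by rewrite (mem_normal_Hall (nilpotent_pcore_Hall p nilA)) ?pcore_normal ?inE.
have [h [k [Ph P'k ->]]] := pcore_decomp p b.
rewrite -{1}(lam_pcoreC Ph P'k) -circE lam_circ (lam_pcoreC P'k).
  by apply: (lamS p); rewrite ?inE ?Sx.
by rewrite (eq_pcore _ (negnK _)).
Qed.

Lemma brace_ideal_local (S : {set B}) : sub_skew_brace S ->
    (forall p, prime p -> forall x a : B,
      x \in S -> x \in 'O_p([set: A]) -> a \in 'O_p([set: A]) ->
      [/\ ((x : A) ^ (a : A)) \in S, ((x : C) ^ (a : C)) \in S & lam a x \in S]) ->
  brace_ideal S.
Proof.
case/andP=> gA gC locS; split=> //.
- apply: (@nilpotent_normal_local A (Group gA) [set: A]%G) => //.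
    exact: subsetT.
  by move=> p pr_p x a /setIP[Sx Px] Pa; have [] := locS p pr_p x a Sx Px Pa.
- apply: (@lam_local (Group gA)) => p pr_p x a /setIP[Sx Px] Pa.
  by have [] := locS p pr_p x a Sx Px Pa.
apply: (@nilpotent_normal_local C (Group gC) [set: C]%G) => //.
  exact: subsetT.
move=> p pr_p x a; rewrite !pcore_circE => /setIP[Sx Px] Pa.
by have [] := locS p pr_p x a Sx Px Pa.
Qed.

End Nilpotent.

(** * Cyclic circle group *)

Lemma dedekind_circ_cyclic :
  cyclic [set: C] -> nilpotent [set: A] -> dedekind B.
Proof.
move=> cycC nilA; have nilC := abelian_nil (cyclic_abelian cycC).
move=> S subS; apply: brace_ideal_local => // p pr_p x a Sx Px Pa.
have [gA gC] := andP subS.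
pose P := 'O_p([set: A])%G; pose Q := 'O_p([set: C])%G.
pose T := (Group gA :&: P)%G; pose TC := (Group gC :&: Q)%G.
have eqT : T = TC :> {set B} by rewrite /= pcore_circE.
have pP : p.-group P := pcore_pgroup _ _.
have actsQP : [acts Q, on P | lam_gact].
  apply: (introT (acts_lamP Q P)) => b y _ Py.
  by apply: lam_char Py; apply: pcore_char.
have sTP : T \subset P := subsetIr _ _.
have [|I [sIP nIP actsI oI]] := @p_gact_invariant_normal _ _ _ _ lam_gact p
  (logn p #|T|) P Q (subsetT _) (subsetT _) pP (pcore_pgroup _ _) actsQP.
  by apply: dvdn_leq_log; rewrite ?cardG_gt0 ?cardSg.
rewrite -(card_pgroup (pgroupS sTP pP)) in oI.
have lamI : {in P & I, forall b y : A, (lam b y : A) \in I}.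
  move=> b y Pb Iy; rewrite -[b](invgK (b : C)).
  have Qb : (b : C)^-1 \in Q by rewrite groupV /= pcore_circE.
  exact: (elimT (acts_lamP _ _) actsI _ _ Qb Iy).
have gI : group_set (I : {set C}).
  by apply: circ_group_set => b y Ib Iy; apply: lamI => //; apply: (subsetP sIP).
have eqI : I = T :> {set B}.
  rewrite eqT; apply/eqP.
  rewrite (@eq_subG_cyclic C [set: C]%G (Group gI) TC) ?subsetT //.
  by apply/eqP; rewrite -eqT.
have IP y : y \in I -> y \in S by rewrite eqI => /setIP[].
have Ix : x \in I by rewrite eqI inE Sx.
split.
- by apply: IP; rewrite memJ_norm // (subsetP nIP).
- have cax : commute (x : C) (a : C).
    by apply: (centsP (cyclic_abelian cycC)); rewrite inE.
  by rewrite conjgE cax mulKg.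
- exact/IP/lamI.
Qed.

(** * Cyclic additive group *)

Lemma lamX (a x : B) m : lam a ((x : A) ^+ m) = (lam a x : A) ^+ m.
Proof.
elim: m => [|m IHm]; first exact: lam1.
by rewrite !expgS lamM IHm.
Qed.

Section CyclicComponent.

Variables (p n : nat) (P : {group A}) (g : A).
Hypotheses (pr_p : prime p) (defP : P = <[g]> :> {set A}) (oP : #|P| = (p ^ n)%N).
Hypothesis lamP : forall (a : B) (x : A), x \in P -> (lam a x : A) \in P.

Let og : #[g] = (p ^ n)%N. Proof. by rewrite -oP defP. Qed.

Lemma expg_g_mod i j : g ^+ i = g ^+ j -> (i = j %[mod p ^ n])%N.
Proof. by rewrite -og => /eqP; rewrite eq_expg_mod_order => /eqP. Qed.

Lemma lam_expg (a : B) : exists u, forall x : A, x \in P -> lam a x = x ^+ u.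
Proof.
have /cycleP[u lam_g] : (lam a g : A) \in <[g]>.
  by rewrite -defP lamP // defP cycle_id.
exists u => x; rewrite defP => /cycleP[i ->].
by rewrite lamX lam_g -!expgM mulnC.
Qed.

Lemma lam_invariant (S : {group A}) : S \subset P ->
  forall (a : B) (x : A), x \in S -> (lam a x : A) \in S.
Proof.
move=> sSP a x Sx; have [u lam_u] := lam_expg a.
by rewrite lam_u ?groupX // (subsetP sSP).
Qed.

Lemma circ_sub_group_set (S : {group A}) : S \subset P -> group_set (S : {set C}).
Proof. by move=> sSP; apply: circ_group_set => a x _; apply: lam_invariant. Qed.

(** The element [a] lies in a subgroup of order [p^m] of the circle group, and
[lambda] is multiplicative, so the multiplier [u] of [a] satisfies
[u^(p^m) = 1]. *)
Lemma lam_expg_order (S : {group A}) (a : B) u m : S \subset P ->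
    a \in S -> #|S| = (p ^ m)%N -> (forall x : A, x \in P -> lam a x = x ^+ u) ->
  (u ^ (p ^ m) = 1 %[mod p ^ n])%N.
Proof.
move=> sSP Sa oS lam_u.
have lamX_u i : lam ((a : C) ^+ i) g = g ^+ (u ^ i).
  elim: i => [|i IHi]; first by rewrite lam_1.
  by rewrite expgS lam_circ IHi lam_u ?defP ?mem_cycle // -expgM expnSr.
have a1 : (a : C) ^+ (p ^ m) = 1.
  by rewrite -oS; apply: (@expg_cardG C (Group (circ_sub_group_set sSP))).
apply/eqP; rewrite -og -eq_expg_mod_order -lamX_u a1 lam_1; exact: eqxx.
Qed.

(** Induction on the order of the subgroup.  If the subgroup of order [p^m] is
normal in [P] for [\circ], its quotient in the subgroup of order [p^(m+2)] is an
abelian circle group; this fixes the multipliers of the elements of the subgroup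
of order [p^(m+1)] modulo [p^2], hence modulo [p^(n-m-1)], and makes that subgroup
normal too.  When [m + 1 = n] it is [P] itself. *)
Lemma circ_conj_cycle_expg m : m <= n ->
  {in <[g ^+ (p ^ (n - m))]> & P, forall x a : B,
     ((x : C) ^ (a : C) : B) \in <[g ^+ (p ^ (n - m))]>}.
Proof.
pose U i := <[g ^+ (p ^ (n - i))]>%G.
have p_gt0 := prime_gt0 pr_p; have p_gt1 := prime_gt1 pr_p.
have sUP i : U i \subset P by rewrite defP cycleX.
have oU i : i <= n -> #|U i| = (p ^ i)%N.
  move=> le_in; rewrite -[#|_|]/(#[_]) orderXdiv og ?dvdn_exp2l ?leq_subr //.
  by rewrite -expnB ?leq_subr // subKn.
have sU i : i < n -> U i \subset U i.+1.
  move=> lt_in; rewrite cycle_subG /= -[(n - i)%N]prednK ?subn_gt0 //.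
  by rewrite -subnS expnSr expgM mem_cycle.
have gC i : group_set (U i : {set C}) := circ_sub_group_set (sUP i).
have cP := cyclic_abelian (cycle_cyclic g); rewrite -defP in cP.
elim: m => [_ x a|m IHm lt_mn x a Ux Pa].
  rewrite subn0 -og expg_order cycle1 => /set1P-> _.
  have -> : (1 : A) = (1 : C) :> B by rewrite circ1E.
  by rewrite conj1g circ1E; apply: set11.
have Px : x \in P := subsetP (sUP m.+1) x Ux.
have [le_nm | lt_m1n] := leqP n m.+1.
  have -> : <[g ^+ (p ^ (n - m.+1))]> = P.
    by rewrite (eqP le_nm) expg1 -defP.
  exact: (@groupJ C (Group (circ_sub_group_set (subxx P)))).
have [u lam_u] := lam_expg x.
have ux := lam_expg_order (sUP _) Ux (oU _ lt_mn) lam_u.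
pose k := (n - m.+2)%N.
have k1 : (n - m.+1)%N = k.+1 by rewrite /k subnSK.
have k2 : (n - m)%N = k.+2 by rewrite -k1 subnSK.
have def_n : n = (k + 2 + m)%N by rewrite addn2 -k2 subnK // ltnW // ltnW.
pose y := g ^+ (p ^ k).
have Uy : y \in U m.+2 by apply: cycle_id.
have Py : y \in P := subsetP (sUP m.+2) y Uy.
(* The elements x and y commute in the circle group modulo U m. *)
have u1 : (u = 1 %[mod p ^ 2])%N.
  have [v lam_v] := lam_expg y.
  (* A p-group acts trivially on a group of order p: here v is its own p^n-th
     power modulo p, by Fermat. *)
  have v1 : (v = 1 %[mod p])%N.
    have := lam_expg_order (subxx P) Py oP lam_v.
    rewrite -(fermat_iter v n pr_p) => vn.
    have p_dv_pn : p %| p ^ n by rewrite dvdn_exp // def_n addn2.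
    by rewrite -(modn_dvdm _ p_dv_pn) vn modn_dvdm.
  have [c Uc xyE] : exists2 c : B, c \in U m &
      (x : C) * (y : C) = ((y : C) * (x : C)) * (c : C).
    have sUU : Group (gC m) \subset Group (gC m.+2).
      apply: subset_trans (_ : Group (gC m.+1) \subset _); exact: sU.
    have nU : Group (gC m.+2) \subset 'N(Group (gC m)).
      apply/subsetP=> b Ub; rewrite inE; apply/subsetP=> _ /imsetP[z Uz ->].
      by apply: IHm => //; [do 2!apply: ltnW | apply: (subsetP (sUP m.+2))].
    have abUU : abelian (Group (gC m.+2) / Group (gC m)).
      apply: (card_p2group_abelian pr_p).
      rewrite card_quotient // -divgS // [#|_|]oU // [in X in _ %/ X]oU.
        by rewrite -expnB ?(leqW (leqnSn m)) // subSn ?leqnSn // subSnn.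
      by do 2!apply: ltnW.
    exists [~ (x : C), (y : C)]; last by rewrite -commgC.
    have := der1_min nU abUU; move/subsetP; apply.
    apply: mem_commg => //.
    exact: (subsetP (sU _ lt_m1n)).
  have [w lam_w] := lam_expg ((y : C) * (x : C)).
  have Pc : c \in P := subsetP (sUP m) c Uc.
  move: xyE; rewrite (circE x y) (circE ((y : C) * (x : C)) c) lam_w //.
  rewrite (circE y x) lam_u // lam_v //.
  have /cycleP[i ->] := Ux; have /cycleP[l ->] := Uc.
  rewrite k1 k2 /y -!expgM -!expgD => /expg_g_mod.
  by rewrite def_n -addnA => /(mod_p2_cancel p_gt0 v1).
have uk : (u = 1 %[mod p ^ k.+1])%N.
  by rewrite -k1; apply: lifting_exponent.
(* By the congruence uk, lambda_x a is a + t with t in U m.+1. *)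
pose t : A := (a : A) ^+ u * (a : A)^-1.
have Ut : t \in U m.+1.
  by rewrite /= k1; apply: expg_mod1_mem; rewrite // -defP.
have -> : (x : C) ^ (a : C) = lam (a : C)^-1 ((x : A) * t).
  apply: (mulgI (a : C)); rewrite conjgE mulKVg (circE x a).
  rewrite (circE a (lam _ _)) lamVK lam_u // mulgA (centsP cP a _ x) // -mulgA.
  by rewrite /t (centsP cP (a ^+ u)) ?groupV ?groupX // mulKVg.
by apply: (lam_invariant (sUP m.+1)); rewrite groupM.
Qed.

Lemma circ_conj_sub (S : {group A}) : S \subset P ->
  {in S & P, forall x a : B, ((x : C) ^ (a : C) : B) \in S}.
Proof.
move=> sSP.
have /p_natP[m oS] : p.-nat #|S|.
  by rewrite (pnat_dvd (cardSg sSP)) // oP pnatX pnat_id.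
have le_mn : m <= n.
  by rewrite -(leq_exp2l _ _ (prime_gt1 pr_p)) -oS -oP subset_leq_card.
suff -> : (S : {set A}) = <[g ^+ (p ^ (n - m))]> by apply: circ_conj_cycle_expg.
have sUP : <[g ^+ (p ^ (n - m))]> \subset P by rewrite defP cycleX.
have cycP : cyclic P by rewrite defP cycle_cyclic.
apply/eqP; rewrite (eq_subG_cyclic cycP) // oS.
rewrite -[#|<[_]>|]/(#[_]) orderXdiv og ?dvdn_exp2l ?leq_subr //.
by rewrite -expnB ?prime_gt0 ?leq_subr // subKn.
Qed.

End CyclicComponent.

Lemma dedekind_add_cyclic :
  cyclic [set: A] -> nilpotent [set: C] -> dedekind B.
Proof.
move=> cycA nilC; have nilA := abelian_nil (cyclic_abelian cycA).
move=> S subS; apply: brace_ideal_local => // p pr_p x a Sx Px Pa.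
have [gA gC] := andP subS.
pose P := 'O_p([set: A])%G.
have sSP : (Group gA :&: P)%G \subset P by apply: subsetIr.
have /cyclicP[g defP] : cyclic P := cyclicS (subsetT _) cycA.
have [n oP] := p_natP (pcore_pgroup p [set: A]).
have lamP : forall (b : B) (y : A), y \in P -> (lam b y : A) \in P.
  by move=> b y Py; apply: lam_char Py; apply: pcore_char.
have SPx : x \in (Group gA :&: P)%G by rewrite inE Sx.
split.
- have cax : commute (x : A) (a : A).
    by apply: (centsP (cyclic_abelian cycA)); rewrite inE.
  by rewrite conjgE cax mulKg.
- by have /setIP[] := circ_conj_sub pr_p defP oP lamP sSP SPx Pa.
- by have /setIP[] := lam_invariant defP lamP sSP a SPx.
Qed.

End SkewBrace.

Theorem corollary4p2 (B : finSkewBraceType)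
    (hB : (cyclic [set: addgroup B] /\ nilpotent [set: circgroup B]) \/
          (cyclic [set: circgroup B] /\ nilpotent [set: addgroup B])) :
  dedekind B.
Proof.
case: hB => [[cycA nilC] | [cycC nilA]].
  exact: dedekind_add_cyclic.
exact: dedekind_circ_cyclic.
Qed.
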